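(* Let $\mathbf{k}$ be a field, $X=\{x_i\mid i\in I\}$ a well-ordered set, let $[X^+]_\omega$ carry the deg-lex-center ordering, and let $T$ be the subset of $Di\langle X\rangle$ consisting of the polynomials $[u]_m\vdash[v]_n-[v]_n\dashv[u]_m$, where $[u]_m,[v]_n\in[X^+]_\omega$. Then: (i) $Di\langle X\mid T\rangle=Di\langle X\mid S\rangle$ (i.e. $Id(T)=Id(S)$), where $S$ consists of the nonzero polynomials among $$[u]_m-\lfloor u\rfloor_{\tau_u(m)}\qquad([u]_m\in[X^+]_\omega,\ |u|\ge2).$$ (ii) $S$ is a Gröbner-Shirshov basis in $Di\langle X\rangle$. (iii) The set $$\{\lfloor x_{i_1}\cdots x_{i_{t-1}}x_{i_t}x_{i_{t+1}}\cdots x_{i_l}\rfloor_t\mid x_{i_1}\le\cdots\le x_{i_{t-1}}<x_{i_t}\le x_{i_{t+1}}\le\cdots\le x_{i_l},\ x_{i_j}\in X,\ 1\le j\le l,\ l,t\in\mathbb{Z}^+,\ t\le l\}$$ is a $\mathbf{k}$-basis of the free abelian dialgebra $Di\langle X\mid T\rangle$.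
   Context: Free dialgebra. A dialgebra over $\mathbf{k}$ is a $\mathbf{k}$-module with two $\mathbf{k}$-bilinear associative products $\vdash,\dashv$ satisfying $a\dashv(b\vdash c)=a\dashv(b\dashv c)$, $(a\dashv b)\vdash c=(a\vdash b)\vdash c$, $a\vdash(b\dashv c)=(a\vdash b)\dashv c$; it is abelian if $a\vdash b=b\dashv a$ for all $a,b$. $X^+$ is the set of nonempty words on $X$, $X^*$ the set of all words including the empty one, $|u|$ the length of $u$. $[X^+]_\omega=\{[u]_m\mid u\in X^+,\ 1\le m\le |u|\}$ is the set of normal diwords (formal pairs $(u,m)$); $u$ is the associative word and $p([u]_m)=m$ the position of center. $Di\langle X\rangle$ is the $\mathbf{k}$-space with basis $[X^+]_\omega$ and products $[u]_m\vdash[v]_n=[uv]_{|u|+n}$, $[u]_m\dashv[v]_n=[uv]_m$ extended bilinearly; it is the free dialgebra on $X$ ($x\in X$ is identified with $[x]_1$). An ideal is a subspace closed under both products, on both sides, with arbitrary elements; $Id(S)$ is the ideal generated by $S$ and $Di\langle X\mid S\rangle=Di\langle X\rangle/Id(S)$. For $u\in X^+$, $\lfloor u\rfloor\in X^+$ is the word obtained by rearranging the letters of $u$ in non-decreasing order, and $\lfloor u\rfloor_m$ is the normal diword with associative word $\lfloor u\rfloor$ and position of center $m$. For $u=x_{j_1}\cdots x_{j_n}$ with $\lfloor u\rfloor=x_{i_1}\cdots x_{i_n}$ and $1\le m\le n$, $\tau_u(m)$ is the index $l$ with $x_{i_l}=x_{j_m}$ and either $l=1$ or $x_{i_l}>x_{i_{l-1}}$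 (the position of the first occurrence in $\lfloor u\rfloor$ of the $m$-th letter of $u$). A subset of $[X^+]_\omega$ is said to be a basis of a quotient if the images of its elements are distinct and form a basis. Orderings. The deg-lex ordering on $X^+$ compares words first by length and then lexicographically from the left. The deg-lex-center ordering on $[X^+]_\omega$: $[u]_m>[v]_n$ iff $(u,m)>(v,n)$ lexicographically (words compared by deg-lex). For $0\ne f\in Di\langle X\rangle$: $\overline f$ is the leading (largest) normal diword of $f$, $lc(f)$ its coefficient, $lt(f)=lc(f)\overline f$, $\widetilde f$ the associative word of $\overline f$, $r_f=f-lt(f)$. By convention $0$ is smaller than every diword and every word, and $\overline 0=\widetilde 0=0$. $f\neq0$ is monic if $lc(f)=1$; a set is monic if all its elements are. $f\ne0$ is strong if $\widetilde f>\widetilde{r_f}$ (in particular if $r_f=0$). Normal $S$-diwords ($S$ monic). For $s\in S$, $a,b\in X^*$ put $P([asb])=\{n: 1\le n\le|a|\}\cup\{|a|+p(\overline s)\}\cup\{n:|a\widetilde s|<n\le|a\widetilde sb|\}$ if $s$ is strong, and $P([asb])=\{|a|+p(\overline s)\}$ if $s$ is not strong. For $l\in P([asb])$ the normal $S$-diword $[asb]_l$ is the element: $[a]_l\dashv s\dashv[b]_1$ if $l\le|a|$; $[a]_{|a|}\vdash s\dashv[b]_1$ if $l=|a|+p(\overline s)$; $[a]_{|a|}\vdash s\vdash[b]_{l-|a\widetilde s|}$ if $l>|a\widetilde s|$ (factors with empty word omitted). One has $\overline{[asb]_l}=[a\widetilde sb]_l$. Compositions of monic $f,g\in Di\langle X\rangle$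 (same notation $[afb]_l$, $P$ used for single polynomials): 1) If $f$ is not strong: $x\dashv f$ for all $x\in X$ and $f\vdash[u]_{|u|}$ for all $u\in X^+$. 2) If $w=\widetilde f=a\widetilde gb$, $a,b\in X^*$: if $p(\overline f)\in P([agb])$, $f-[agb]_{p(\overline f)}$; if $p(\overline f)\notin P([agb])$ and both $f,g$ are strong, for every $x\in X$, $[xf]_1-[xagb]_1$ and $[fx]_{|wx|}-[agbx]_{|wx|}$. 3) If $w=\widetilde fb=a\widetilde g$, $a,b\in X^*$, $|\widetilde f|+|\widetilde g|>|w|$: if $P([fb])\cap P([ag])\ne\varnothing$, for every $m$ in it $[fb]_m-[ag]_m$; if $P([fb])\cap P([ag])=\varnothing$ and both $f,g$ are strong, for every $x\in X$, $[xfb]_1-[xag]_1$ and $[fbx]_{|wx|}-[agx]_{|wx|}$. $h$ is trivial modulo $S$ if $h=\sum\alpha_i[a_is_ib_i]_{m_i}$ is a finite sum with $\alpha_i\in\mathbf{k}$, $[a_is_ib_i]_{m_i}$ normal $S$-diwords and $\overline{[a_is_ib_i]_{m_i}}\le\overline h$. A monic set $S$ is a Gröbner-Shirshov basis in $Di\langle X\rangle$ if every composition of elements of $S$ is trivial modulo $S$. *)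

(* Defs.v *)
From HB Require Import structures.
From mathcomp Require Import all_boot all_order all_algebra.
From mathcomp Require Import finmap.
From mathcomp.multinomials Require Import monalg.
From mathcomp Require Import boolp classical_sets wochoice.
From mathcomp Require Import generic_quotient ring_quotient.

Set Implicit Arguments.
Unset Strict Implicit.
Unset Printing Implicit Defensive.

Import Order.TTheory GRing.Theory.

Local Open Scope fset_scope.
Local Open Scope classical_set_scope.
Local Open Scope ring_scope.
Local Open Scope quotient_scope.

Reserved Notation "x ⊢ y" (at level 40, left associativity).
Reserved Notation "x ⊣ y" (at level 40, left associativity).

HB.mixin Record isDialgebra (k : fieldType) D of GRing.Lmodule k D := {
  dlv : D -> D -> D;
  drv : D -> D -> D;
  dlv_linearl : forall (c : k) x y z, dlv (c *: x + y) z = c *: dlv x z + dlv y z;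
  dlv_linearr : forall (c : k) x y z, dlv z (c *: x + y) = c *: dlv z x + dlv z y;
  drv_linearl : forall (c : k) x y z, drv (c *: x + y) z = c *: drv x z + drv y z;
  drv_linearr : forall (c : k) x y z, drv z (c *: x + y) = c *: drv z x + drv z y;
  dlvA : associative dlv;
  drvA : associative drv;
  drv_lv : forall a b c, drv a (dlv b c) = drv a (drv b c);
  dlv_rv : forall a b c, dlv (drv a b) c = dlv (dlv a b) c;
  dlv_drvA : forall a b c, dlv a (drv b c) = drv (dlv a b) c;
}.

#[short(type="dialgebraType")]
HB.structure Definition Dialgebra (k : fieldType) :=
  {D of isDialgebra k D & GRing.Lmodule k D}.

Notation "x ⊢ y" := (dlv x y) : ring_scope.
Notation "x ⊣ y" := (drv x y) : ring_scope.

Definition abelian (k : fieldType) (D : dialgebraType k) : Prop :=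
  forall a b : D, a ⊢ b = b ⊣ a.

Section Ideals.
Variables (k : fieldType) (D : dialgebraType k).

Definition is_ideal (J : set D) : Prop :=
  [/\ J 0,
      forall (c : k) x y, J x -> J y -> J (c *: x + y) &
      forall x y, J x -> [/\ J (x ⊢ y), J (y ⊢ x), J (x ⊣ y) & J (y ⊣ x)]].

Definition Id (S : set D) : set D := smallest is_ideal S.

Lemma Id_is_ideal (S : set D) : is_ideal (Id S).
Proof.
split=> [J [[J0 _ _] _] //|c x y Sx Sy J SJ|x y Sx].
  by case: (SJ) => -[_ JP _] _; apply: JP; [exact: Sx|exact: Sy].
by split=> J SJ; case: (SJ) => -[_ _ /(_ x y (Sx J SJ))[]].
Qed.

Definition Idp (S : set D) : {pred D} := fun x => `[< Id S x >].

Lemma IdpE (S : set D) x : (x \in Idp S) = `[< Id S x >].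
Proof. by []. Qed.

Lemma Idp_zmod_closed (S : set D) : zmod_closed (Idp S).
Proof.
have [I0 IP _] := Id_is_ideal S; split=> [|x y /asboolP Sx /asboolP Sy].
  exact/asboolP.
by apply/asboolP; rewrite addrC -scaleN1r; apply: IP.
Qed.

HB.instance Definition _ (S : set D) :=
  GRing.isZmodClosed.Build D (Idp S) (Idp_zmod_closed S).

Definition dquot (S : set D) := Quotient.quot (Idp S).

HB.instance Definition _ (S : set D) := EqQuotient.on (dquot S).
HB.instance Definition _ (S : set D) := GRing.Zmodule.on (dquot S).

Section Quotient.
Variable S : set D.
Local Notation Q := (dquot S).
Local Notation pi := (\pi_Q : D -> Q).

Lemma dquot_eq (x y : D) : pi x = pi y <-> Id S (x - y).
Proof.
split=> [/eqP|xy]; first by rewrite -Quotient.idealrBE => /asboolP.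
by apply/eqP; rewrite -Quotient.idealrBE; apply/asboolP.
Qed.

Lemma dquot_repr (x : D) : Id S (repr (pi x) - x).
Proof. by apply/dquot_eq; rewrite reprK. Qed.

Lemma dquot_piD (x y : D) : pi (x + y) = pi x + pi y.
Proof. by rewrite !piE. Qed.

Definition qscale (c : k) (x : Q) : Q := locked (pi (c *: repr x)).
Definition qlv (x y : Q) : Q := locked (pi (repr x ⊢ repr y)).
Definition qrv (x y : Q) : Q := locked (pi (repr x ⊣ repr y)).

Lemma pi_qscale c x : qscale c (pi x) = pi (c *: x).
Proof.
rewrite /qscale -lock; have [I0 IP _] := Id_is_ideal S; apply/dquot_eq.
by rewrite -scalerBr -[_ *: _]addr0; apply: IP => //; apply: dquot_repr.
Qed.

Lemma pi_qlv x y : qlv (pi x) (pi y) = pi (x ⊢ y).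
Proof.
rewrite /qlv -lock; have [I0 IP IM] := Id_is_ideal S; apply/dquot_eq.
set x' := repr _; set y' := repr _.
have -> : x' ⊢ y' - x ⊢ y = 1 *: ((x' - x) ⊢ y') + x ⊢ (y' - y).
  rewrite scale1r [x' - x]addrC [y' - y]addrC -!scaleN1r.
  rewrite dlv_linearl dlv_linearr !scaleN1r [X in _ = X + _]addrC.
  by rewrite [X in _ = _ + X]addrC addrA addrNK.
by apply: IP; [case: (IM _ y' (dquot_repr x))|case: (IM _ x (dquot_repr y))].
Qed.

Lemma pi_qrv x y : qrv (pi x) (pi y) = pi (x ⊣ y).
Proof.
rewrite /qrv -lock; have [I0 IP IM] := Id_is_ideal S; apply/dquot_eq.
set x' := repr _; set y' := repr _.
have -> : x' ⊣ y' - x ⊣ y = 1 *: ((x' - x) ⊣ y') + x ⊣ (y' - y).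
  rewrite scale1r [x' - x]addrC [y' - y]addrC -!scaleN1r.
  rewrite drv_linearl drv_linearr !scaleN1r [X in _ = X + _]addrC.
  by rewrite [X in _ = _ + X]addrC addrA addrNK.
by apply: IP; [case: (IM _ y' (dquot_repr x))|case: (IM _ x (dquot_repr y))].
Qed.

Lemma qscaleA a b x : qscale a (qscale b x) = qscale (a * b) x.
Proof. by rewrite -[x]reprK !pi_qscale scalerA. Qed.

Lemma qscale1 : left_id 1 qscale.
Proof. by move=> x; rewrite -[x]reprK pi_qscale scale1r. Qed.

Lemma qscaleDr : right_distributive qscale +%R.
Proof.
move=> c x y; rewrite -[x]reprK -[y]reprK -dquot_piD !pi_qscale scalerDr.
exact: dquot_piD.
Qed.

Lemma qscaleDl x : {morph qscale^~ x : a b / a + b}.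
Proof.
by move=> a b; rewrite -[x]reprK !pi_qscale scalerDl; apply: dquot_piD.
Qed.

HB.instance Definition _ :=
  GRing.Zmodule_isLmodule.Build k Q qscaleA qscale1 qscaleDr qscaleDl.

Lemma dquot_piZ c (x : D) : pi (c *: x) = c *: pi x.
Proof. by rewrite -pi_qscale. Qed.

Let piP c x y : c *: pi x + pi y = pi (c *: x + y).
Proof. by rewrite dquot_piD dquot_piZ. Qed.

Lemma qlv_linearl (c : k) (x y z : Q) :
  qlv (c *: x + y) z = c *: qlv x z + qlv y z.
Proof.
rewrite -[x]reprK -[y]reprK -[z]reprK.
by rewrite piP !pi_qlv dlv_linearl -piP.
Qed.

Lemma qlv_linearr (c : k) (x y z : Q) :
  qlv z (c *: x + y) = c *: qlv z x + qlv z y.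
Proof.
rewrite -[x]reprK -[y]reprK -[z]reprK.
by rewrite piP !pi_qlv dlv_linearr -piP.
Qed.

Lemma qrv_linearl (c : k) (x y z : Q) :
  qrv (c *: x + y) z = c *: qrv x z + qrv y z.
Proof.
rewrite -[x]reprK -[y]reprK -[z]reprK.
by rewrite piP !pi_qrv drv_linearl -piP.
Qed.

Lemma qrv_linearr (c : k) (x y z : Q) :
  qrv z (c *: x + y) = c *: qrv z x + qrv z y.
Proof.
rewrite -[x]reprK -[y]reprK -[z]reprK.
by rewrite piP !pi_qrv drv_linearr -piP.
Qed.

Lemma qlvA : associative qlv.
Proof.
move=> x y z; rewrite -[x]reprK -[y]reprK -[z]reprK.
by rewrite !pi_qlv dlvA.
Qed.

Lemma qrvA : associative qrv.
Proof.
move=> x y z; rewrite -[x]reprK -[y]reprK -[z]reprK.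
by rewrite !pi_qrv drvA.
Qed.

Lemma qrv_lv x y z : qrv x (qlv y z) = qrv x (qrv y z).
Proof.
rewrite -[x]reprK -[y]reprK -[z]reprK.
by rewrite pi_qlv !pi_qrv drv_lv.
Qed.

Lemma qlv_rv x y z : qlv (qrv x y) z = qlv (qlv x y) z.
Proof.
rewrite -[x]reprK -[y]reprK -[z]reprK.
by rewrite pi_qrv !pi_qlv dlv_rv.
Qed.

Lemma qlv_drvA x y z : qlv x (qrv y z) = qrv (qlv x y) z.
Proof.
rewrite -[x]reprK -[y]reprK -[z]reprK.
by rewrite pi_qrv !pi_qlv pi_qrv dlv_drvA.
Qed.

HB.instance Definition _ := isDialgebra.Build k Q
  qlv_linearl qlv_linearr qrv_linearl qrv_linearr
  qlvA qrvA qrv_lv qlv_rv qlv_drvA.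

Lemma dquot_pi_lv (x y : D) : (pi x : Q) ⊢ pi y = pi (x ⊢ y).
Proof. exact: pi_qlv. Qed.

Lemma dquot_pi_rv (x y : D) : (pi x : Q) ⊣ pi y = pi (x ⊣ y).
Proof. exact: pi_qrv. Qed.

End Quotient.
End Ideals.

Section Bases.
Variables (k : fieldType) (V : lmodType k).

Definition lin_indep (B : set V) : Prop :=
  forall (e : seq V) (c : V -> k), uniq e -> (forall v, v \in e -> B v) ->
    \sum_(v <- e) c v *: v = 0 -> forall v, v \in e -> c v = 0.

Definition lin_span (B : set V) : set V :=
  [set v | exists (e : seq V) (c : V -> k),
     (forall u, u \in e -> B u) /\ v = \sum_(u <- e) c u *: u].

Definition is_basis (B : set V) : Prop := lin_indep B /\ lin_span B = setT.

End Bases.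

Definition is_quot_basis (k : fieldType) (D : dialgebraType k)
    (S : set D) (B : set D) : Prop :=
  let pi := (\pi_(dquot S) : D -> dquot S) in
  {in B &, injective pi} /\ is_basis (pi @` B).

Section Diwords.
Variables (d : Order.disp_t) (X : orderType d).

Record diword := Diword {
  diword_val :> seq X * nat;
  _ : (0 < diword_val.2 <= size diword_val.1)%N }.

HB.instance Definition _ := [isSub for diword_val].
HB.instance Definition _ := [Choice of diword by <:].

Implicit Types (u v w : diword) (a b s : seq X).

Definition word w : seq X := (val w).1.
(** Positions are counted from 1. *)
Definition center w : nat := (val w).2.

Lemma diwordP w : (0 < center w <= size (word w))%N.
Proof. exact: (valP w). Qed.

Lemma dwlv_subproof u v :
  (0 < size (word u) + center v <= size (word u ++ word v))%N.
Proof.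
case/andP: (diwordP v) => v0 v1.
by rewrite addn_gt0 v0 orbT size_cat leq_add2l.
Qed.
Definition dwlv u v := @Diword (_, _) (dwlv_subproof u v).

Lemma dwrv_subproof u v : (0 < center u <= size (word u ++ word v))%N.
Proof.
case/andP: (diwordP u) => u0 u1.
by rewrite u0 size_cat (leq_trans u1) ?leq_addr.
Qed.
Definition dwrv u v := @Diword (_, _) (dwrv_subproof u v).

Lemma dwletter_subproof (x : X) : (0 < 1 <= size [:: x])%N.
Proof. by []. Qed.
Definition dwletter x := @Diword (_, _) (dwletter_subproof x).

Definition deglex_lt a b : bool :=
  (size a < size b)%N ||
  (size a == size b) && ((a : seqlexi X) < (b : seqlexi X))%O.

Definition diword_le u v : bool :=
  deglex_lt (word u) (word v) ||
  (word u == word v) && (center u <= center v)%N.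

Definition floorw a : seq X := sort <=%O a.

(** Position, counted from 1, of the first occurrence in [floorw a] of the
    [m]-th letter of [a]. *)
Definition tau a (m : nat) : nat :=
  oapp (fun x => (index x (floorw a)).+1) 1%N (onth a m.-1).

Lemma dfloor_subproof w : (0 < center w <= size (floorw (word w)))%N.
Proof. by rewrite size_sort diwordP. Qed.
(** ⌊u⌋_m *)
Definition dfloor w := @Diword (_, _) (dfloor_subproof w).

Lemma dfloor_tau_subproof w :
  (0 < tau (word w) (center w) <= size (floorw (word w)))%N.
Proof.
case/andP: (diwordP w); case: (center w) => // m _ mw; rewrite /tau /=.
case: (word w) mw => // x0 u mu; rewrite onthE (nth_map x0) //= index_mem mem_sort.
exact: mem_nth.
Qed.
(** ⌊u⌋_(τ_u(m)) *)
Definition dfloor_tau w := @Diword (_, _) (dfloor_tau_subproof w).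

(** x_1 <= ... <= x_(t-1) < x_t <= ... <= x_l, the center being [t]; the
    index [i] counts from 0. *)
Definition center_first w : Prop :=
  forall (x0 : X) (i : nat), (i.+1 < size (word w))%N ->
    if i.+2 == center w then (nth x0 (word w) i < nth x0 (word w) i.+1)%O
    else (nth x0 (word w) i <= nth x0 (word w) i.+1)%O.

End Diwords.

Section LinearExtension.
Variables (k : fieldType) (K : choiceType).
Local Notation A := {malg k[K]}.

Definition lin_ext (V : lmodType k) (h : K -> V) (f : A) : V :=
  \sum_(w <- msupp f) f@_w *: h w.

Lemma lin_extEw (V : lmodType k) (h : K -> V) (f : A) (s : {fset K}) :
  (msupp f `<=` s)%fset -> lin_ext h f = \sum_(w <- s) f@_w *: h w.
Proof.
move=> fs; rewrite /lin_ext (big_fset_incl _ fs) // => w _ /mcoeff_outdom ->.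
by rewrite scale0r.
Qed.

Lemma lin_extP (V : lmodType k) (h : K -> V) c (f g : A) :
  lin_ext h (c *: f + g) = c *: lin_ext h f + lin_ext h g.
Proof.
pose s := (msupp f `|` msupp g)%fset.
have fs : (msupp f `<=` s)%fset by exact: fsubsetUl.
have gs : (msupp g `<=` s)%fset by exact: fsubsetUr.
rewrite (lin_extEw h fs) (lin_extEw h gs) (@lin_extEw _ _ _ s).
  rewrite scaler_sumr -big_split /=; apply: eq_bigr => w _.
  by rewrite mcoeffD mcoeffZ scalerDl scalerA.
apply: fsubset_trans (msuppD_le _ _) _.
by rewrite fsubUset gs andbT; apply: fsubset_trans fs; apply: msuppZ_le.
Qed.

Lemma lin_extU (V : lmodType k) (h : K -> V) (w : K) : lin_ext h << w >> = h w.
Proof.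
by rewrite /lin_ext msuppU oner_eq0 big_seq_fset1 mcoeffUU scale1r.
Qed.

Lemma eq_lin_ext (V : lmodType k) (h h' : K -> V) :
  h =1 h' -> lin_ext h =1 lin_ext h'.
Proof. by move=> hh f; apply: eq_bigr => w _; rewrite hh. Qed.

Lemma malg_lin_ind (P : A -> Prop) :
  P 0 -> (forall c f g, P f -> P g -> P (c *: f + g)) ->
  (forall w, P << w >>) -> forall f, P f.
Proof.
move=> P0 PD PU f; rewrite [f]monalgE.
apply: big_ind => // [f1 f2 P1 P2|w _].
  by rewrite -[f1]scale1r; apply: PD.
have -> : << f@_w *g w >> = f@_w *: << w >> + 0 :> A.
  by apply/malgP => v; rewrite addr0 mcoeffZ !mcoeffU mulrnAr mulr1.
exact: PD.
Qed.

Definition bilin_ext (op : K -> K -> K) (f g : A) : A :=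
  lin_ext (fun u => lin_ext (fun v => << op u v >> : A) g) f.

Section BilinExt.
Variable op : K -> K -> K.

Lemma bilin_extPl c f1 f2 g : bilin_ext op (c *: f1 + f2) g =
  c *: bilin_ext op f1 g + bilin_ext op f2 g.
Proof. exact: lin_extP. Qed.

Lemma bilin_extPr c f1 f2 g : bilin_ext op g (c *: f1 + f2) =
  c *: bilin_ext op g f1 + bilin_ext op g f2.
Proof.
rewrite /bilin_ext /lin_ext scaler_sumr -big_split /=.
apply: eq_bigr => u _; rewrite -!/(lin_ext _ _) lin_extP scalerDr !scalerA.
by rewrite mulrC.
Qed.

Lemma bilin_extUU u v : bilin_ext op << u >> << v >> = << op u v >>.
Proof. by rewrite /bilin_ext !lin_extU. Qed.

Lemma bilin_ext0l g : bilin_ext op 0 g = 0.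
Proof. by rewrite /bilin_ext /lin_ext msupp0 big_seq_fset0. Qed.

Lemma bilin_ext0r g : bilin_ext op g 0 = 0.
Proof.
have := bilin_extPr 1 0 0 g.
by rewrite !scale1r addr0 => /(congr1 (fun x => x - bilin_ext op g 0)); rewrite addrK subrr.
Qed.

End BilinExt.

Lemma bilin_extA (o1 o2 o3 o4 : K -> K -> K) :
  (forall u v w, o1 u (o2 v w) = o3 (o4 u v) w) ->
  forall f g h : A, bilin_ext o1 f (bilin_ext o2 g h) =
                    bilin_ext o3 (bilin_ext o4 f g) h.
Proof.
move=> oA f g h; elim/malg_lin_ind: f => [|c f1 f2 IH1 IH2|u].
- by rewrite !bilin_ext0l.
- by rewrite !bilin_extPl IH1 IH2.
elim/malg_lin_ind: g => [|c f1 f2 IH1 IH2|v].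
- by rewrite !(bilin_ext0l, bilin_ext0r).
- by rewrite bilin_extPl !bilin_extPr bilin_extPl IH1 IH2.
elim/malg_lin_ind: h => [|c f1 f2 IH1 IH2|w].
- by rewrite !bilin_ext0r.
- by rewrite !bilin_extPr IH1 IH2.
by rewrite !bilin_extUU oA.
Qed.

End LinearExtension.

Section FreeDialgebra.
Variables (k : fieldType) (d : Order.disp_t) (X : orderType d).

Definition Di := {malg k[diword X]}.

HB.instance Definition _ := GRing.Lmodule.on Di.

Definition Di_lv : Di -> Di -> Di := bilin_ext (@dwlv d X).
Definition Di_rv : Di -> Di -> Di := bilin_ext (@dwrv d X).

Let diword_inj (u v : diword X) :
  word u = word v -> center u = center v -> u = v.
Proof.
by move=> uv cuv; apply: val_inj; move: uv cuv; rewrite /word /center;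
  case: (val u) (val v) => [? ?] [? ?] /= -> ->.
Qed.

Lemma dwlvA : associative (@dwlv d X).
Proof.
by move=> u v w; apply: diword_inj; rewrite /word /center /= ?catA // size_cat addnA.
Qed.

Lemma dwrvA : associative (@dwrv d X).
Proof. by move=> u v w; apply: diword_inj; rewrite /word /center /= ?catA. Qed.

Lemma dwrv_lv (u v w : diword X) : dwrv u (dwlv v w) = dwrv u (dwrv v w).
Proof. exact: diword_inj. Qed.

Lemma dwlv_rv (u v w : diword X) : dwlv (dwrv u v) w = dwlv (dwlv u v) w.
Proof. exact: diword_inj. Qed.

Lemma dwlv_rvA (u v w : diword X) : dwlv u (dwrv v w) = dwrv (dwlv u v) w.
Proof. by apply: diword_inj; rewrite /word /center /= ?catA. Qed.

Lemma Di_rv_lv (f g h : Di) : Di_rv f (Di_lv g h) = Di_rv f (Di_rv g h).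
Proof.
transitivity (Di_rv (Di_rv f g) h); last by rewrite /Di_rv (bilin_extA dwrvA).
by apply: bilin_extA => u v w; rewrite dwrv_lv dwrvA.
Qed.

Lemma Di_lv_rv (f g h : Di) : Di_lv (Di_rv f g) h = Di_lv (Di_lv f g) h.
Proof.
transitivity (Di_lv f (Di_lv g h)); last by rewrite /Di_lv (bilin_extA dwlvA).
by apply/esym/bilin_extA => u v w; rewrite dwlv_rv dwlvA.
Qed.

HB.instance Definition _ := isDialgebra.Build k Di
  (bilin_extPl (@dwlv d X)) (fun c f g h => bilin_extPr (@dwlv d X) c f g h)
  (bilin_extPl (@dwrv d X)) (fun c f g h => bilin_extPr (@dwrv d X) c f g h)
  (bilin_extA dwlvA) (bilin_extA dwrvA) Di_rv_lv Di_lv_rv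
  (bilin_extA dwlv_rvA).

Definition base (w : diword X) : Di := << w >>.

Lemma Di_ind (P : Di -> Prop) :
  P 0 -> (forall c (f g : Di), P f -> P g -> P (c *: f + g)) ->
  (forall w, P (base w)) -> forall f, P f.
Proof. exact: malg_lin_ind. Qed.

(** The basis element [u]_m; only meaningful when [1 <= m <= size u]. *)
Definition mono (u : seq X) (m : nat) : Di :=
  oapp base 0 (insub (u, m)).

Definition letter (x : X) : Di := base (dwletter x).

Implicit Types (f g h s : Di) (S : set Di) (a b : seq X) (l m n : nat).

(** The leading diword; [None] stands for the leading diword of 0. *)
Definition lead f : option (diword X) :=
  ohead [seq w <- msupp f | all (fun v => diword_le v w) (msupp f)].

Definition lead_le (o1 o2 : option (diword X)) : bool :=
  if o1 is Some u then (if o2 is Some v then diword_le u v else false) else true.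

(** The associative word of the leading diword. The empty word, which is not
    in X^+ and is smaller than all its elements, stands for that of 0. *)
Definition lword f : seq X := oapp (@word d X) [::] (lead f).

Definition lcenter f : nat := oapp (@center d X) 0%N (lead f).

Definition lc f : k := oapp (fun w => f@_w) 0 (lead f).

Definition lterm f : Di := oapp (fun w => << f@_w *g w >>) 0 (lead f).

Definition rest f : Di := f - lterm f.

Definition monic f : Prop := lc f = 1.

Definition strong f : bool := deglex_lt (lword (rest f)) (lword f).

(** [n] is in P([asb]) *)
Definition Pset a s b n : bool :=
  if strong s then
    [|| (1 <= n <= size a)%N,
        n == (size a + lcenter s)%N
      | (size (a ++ lword s) < n <= size (a ++ lword s ++ b))%N]
  else n == (size a + lcenter s)%N.

(** [a]_|a| ⊢ f and f ⊣ [b]_1, the factor being omitted if it is empty *)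
Definition lv_word a f : Di := if a is [::] then f else mono a (size a) ⊢ f.
Definition rv_word f b : Di := if b is [::] then f else f ⊣ mono b 1.

(** [asb]_l, for [l] in P([asb]) *)
Definition nsd a s b l : Di :=
  if (l <= size a)%N then rv_word (mono a l ⊣ s) b
  else if l == (size a + lcenter s)%N then rv_word (lv_word a s) b
  else lv_word a s ⊢ mono b (l - size (a ++ lword s)).

Definition normal_Sdiword S (q : Di) : Prop :=
  exists a s b l, [/\ S s, Pset a s b l & q = nsd a s b l].

Inductive composition (f g : Di) : Di -> Prop :=
| Comp_left x :
    ~~ strong f -> composition f g (letter x ⊣ f)
| Comp_right (u : seq X) :
    ~~ strong f -> u != [::] -> composition f g (f ⊢ mono u (size u))
| Comp_incl a b :
    lword f = a ++ lword g ++ b ->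
    Pset a g b (lcenter f) ->
    composition f g (f - nsd a g b (lcenter f))
| Comp_incl_left a b x :
    lword f = a ++ lword g ++ b ->
    ~~ Pset a g b (lcenter f) -> strong f -> strong g ->
    composition f g (nsd [:: x] f [::] 1 - nsd (x :: a) g b 1)
| Comp_incl_right a b x :
    let w := lword f in
    w = a ++ lword g ++ b ->
    ~~ Pset a g b (lcenter f) -> strong f -> strong g ->
    composition f g (nsd [::] f [:: x] (size (rcons w x))
                     - nsd a g (rcons b x) (size (rcons w x)))
| Comp_inter a b m :
    let w := lword f ++ b in
    w = a ++ lword g -> (size w < size (lword f) + size (lword g))%N ->
    Pset [::] f b m -> Pset a g [::] m ->
    composition f g (nsd [::] f b m - nsd a g [::] m)
| Comp_inter_left a b x :
    let w := lword f ++ b in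
    w = a ++ lword g -> (size w < size (lword f) + size (lword g))%N ->
    (forall m, ~~ (Pset [::] f b m && Pset a g [::] m)) ->
    strong f -> strong g ->
    composition f g (nsd [:: x] f b 1 - nsd (x :: a) g [::] 1)
| Comp_inter_right a b x :
    let w := lword f ++ b in
    w = a ++ lword g -> (size w < size (lword f) + size (lword g))%N ->
    (forall m, ~~ (Pset [::] f b m && Pset a g [::] m)) ->
    strong f -> strong g ->
    composition f g (nsd [::] f (rcons b x) (size (rcons w x))
                     - nsd a g [:: x] (size (rcons w x))).

Definition trivial_mod S h : Prop :=
  exists (n : nat) (c : 'I_n -> k) (q : 'I_n -> Di),
    (forall i, normal_Sdiword S (q i) /\ lead_le (lead (q i)) (lead h)) /\
    h = \sum_(i < n) c i *: q i.

Definition GSB S : Prop :=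
  (forall f, S f -> monic f) /\
  (forall f g h, S f -> S g -> composition f g h -> trivial_mod S h).

Definition Tset : set Di :=
  [set f | exists u v : diword X, f = base u ⊢ base v - base v ⊣ base u].

Definition Sset : set Di :=
  [set f | f != 0 /\
     exists w : diword X, (2 <= size (word w))%N /\ f = base w - base (dfloor_tau w)].

Definition Bset : set Di :=
  [set base (dfloor w) | w in [set w : diword X | center_first w]].

Lemma dquot_Tset_abelian : abelian (dquot Tset).
Proof.
have [I0 IP _] := Id_is_ideal Tset.
suff ab (f g : Di) : Id Tset (f ⊢ g - g ⊣ f).
  by move=> x y; rewrite -[x]reprK -[y]reprK dquot_pi_lv dquot_pi_rv; apply/dquot_eq.
have lin (c : k) (p1 q1 p2 q2 : Di) :
    c *: p1 + p2 - (c *: q1 + q2) = c *: (p1 - q1) + (p2 - q2).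
  by rewrite scalerBr opprD addrACA.
elim/Di_ind: f => [|c f1 f2 IH1 IH2|u].
- by rewrite [0 ⊢ g]bilin_ext0l [g ⊣ 0]bilin_ext0r subr0.
- by rewrite dlv_linearl drv_linearr lin; exact: (IP c _ _ IH1 IH2).
elim/Di_ind: g => [|c g1 g2 IH1 IH2|v].
- by rewrite [0 ⊣ _]bilin_ext0l [_ ⊢ 0]bilin_ext0r subr0.
- by rewrite dlv_linearr drv_linearl lin; exact: (IP c _ _ IH1 IH2).
by apply: sub_gen_smallest; exists u, v.
Qed.

End FreeDialgebra.

Arguments Tset k {d} X.
Arguments Sset k {d} X.
Arguments Bset k {d} X.

(* Main.v *)
(** For a normal diword [w] let [nf w] be the diword carrying the letters of [w]
    in non-decreasing order, its center at the first occurrence of the center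
    letter of [w]. It depends only on the multiset of letters and on the center
    letter of [w], hence [nf], extended linearly, is idempotent and satisfies
    [nf (nf f * nf g) = nf (f * g)] for both products, so that its kernel is an
    ideal, spanned by the [w - nf w].

    This kernel is [Id S] by the definition of [S]. It contains [T], as
    [u ⊢ v] and [v ⊣ u] have the same letters and the same center letter.
    Conversely, in an abelian dialgebra every diword with center letter [x]
    can be rewritten as [x ⊣ y_1 ⊣ ... ⊣ y_n], where the [y_i] commute, so
    [w = nf w] holds modulo [Id T].

    Since compositions of elements of [S] lie in the ideal [Id S], each is a
    combination of the [w - nf w] with [w] in its own support, and such a
    difference is 0 or an element of [S] with leading diword [w]: it is trivial
    modulo [S]. Finally, the diwords fixed by [nf], which are those of the
    basis, span the image of [nf], a complement of its kernel. *)

Require Import Defs.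
From mathcomp Require Import all_boot all_order all_algebra.
From mathcomp Require Import boolp classical_sets wochoice.
From mathcomp Require Import finmap generic_quotient ring_quotient.
From mathcomp.multinomials Require Import monalg.
From mathcomp Require Import zify.

Set Implicit Arguments.
Unset Strict Implicit.
Unset Printing Implicit Defensive.

Import Order.TTheory GRing.Theory.

Local Open Scope ring_scope.
Local Open Scope quotient_scope.

(** * Diwords and their normal forms *)

Section Diwords.
Variables (d : Order.disp_t) (X : orderType d).
Implicit Types (u v w : diword X) (s t : seq X).

Lemma diword_eq u v : word u = word v -> center u = center v -> u = v.
Proof.
by move=> uv cuv; apply: val_inj; move: uv cuv; rewrite /word /center;
  case: (val u) (val v) => [? ?] [? ?] /= -> ->.
Qed.

(** [deglex_lt] and [diword_le] are lexicographic orders on these keys, so that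
    they inherit the order theory of lexicographic products. *)
Definition dlkey s : (nat *l seqlexi X)%type := (size s, s).

Definition diword_key w : (nat *l seqlexi X *l nat)%type :=
  (dlkey (word w), center w).

Lemma dlkey_inj : injective dlkey.
Proof. by move=> s t []. Qed.

Lemma deglex_ltE s t : deglex_lt s t = (dlkey s < dlkey t)%O.
Proof.
rewrite /deglex_lt /dlkey ltxi_pair !leEnat ltn_neqAle.
by case: (ltngtP (size s) (size t)).
Qed.

Lemma diword_key_inj : injective diword_key.
Proof. by move=> u v [] _ uv cuv; apply: diword_eq. Qed.

Lemma diword_leE u v : diword_le u v = (diword_key u <= diword_key v)%O.
Proof.
rewrite /diword_le deglex_ltE lexi_pair leEnat.
rewrite -(inj_eq dlkey_inj).
by case: ltgtP.
Qed.

(** The head of [t] is its least letter, so it is at most the head of [s]; if the heads agree, they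
    cancel and induction applies. *)
Lemma sorted_lexi_min s t : sorted <=%O t -> perm_eq t s ->
  ((t : seqlexi X) <= (s : seqlexi X))%O.
Proof.
elim: t s => [|y t IH] [|z s] // st.
  by move/perm_size.
move=> ts; rewrite lexi_cons.
have yz : (y <= z)%O.
  have : z \in y :: t by rewrite (perm_mem ts) mem_head.
  rewrite inE => /predU1P[-> //|zt].
  by move/(order_path_min le_trans)/allP: st; apply.
rewrite yz; apply/implyP => zy; apply: IH; first exact: path_sorted st.
have zy' : z = y by apply/le_anti; rewrite yz zy.
by move: ts; rewrite zy' perm_cons.
Qed.

(** With the multiset of letters, this is the invariant that determines the normal form. It is never
    [None], by [center_split]. *)
Definition center_letter w : option X := onth (word w) (center w).-1.

Lemma word_lv u v : word (dwlv u v) = word u ++ word v.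
Proof. by []. Qed.

Lemma word_rv u v : word (dwrv u v) = word u ++ word v.
Proof. by []. Qed.

Lemma center_lv u v : center (dwlv u v) = (size (word u) + center v)%N.
Proof. by []. Qed.

Lemma center_rv u v : center (dwrv u v) = center u.
Proof. by []. Qed.

Lemma word_dfloor_tau w : word (dfloor_tau w) = sort <=%O (word w).
Proof. by []. Qed.

Lemma center_dfloor_tau w : center (dfloor_tau w) = tau (word w) (center w).
Proof. by []. Qed.

Lemma center_letter_lv u v : center_letter (dwlv u v) = center_letter v.
Proof.
rewrite /center_letter word_lv center_lv onth_cat; case/andP: (diwordP v).
case: (center v) => // n _ _.
by rewrite addnS /= ltnNge leq_addr /= addKn.
Qed.

Lemma center_letter_rv u v : center_letter (dwrv u v) = center_letter u.
Proof.
rewrite /center_letter word_rv center_rv onth_cat; case/andP: (diwordP u).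
by case: (center u) => // n _ /= ->.
Qed.

Lemma center_split w : exists a x b,
  [/\ word w = a ++ x :: b, center w = (size a).+1 & center_letter w = Some x].
Proof.
case/andP: (diwordP w); rewrite /center_letter.
case: (center w) => // n _ nw; have := nw; rewrite -onthTE /=.
case E: (onth _ _) => [x|//] _; exists (take n (word w)), x, (drop n.+1 (word w)).
rewrite size_takel 1?ltnW //; split=> //.
by rewrite -[LHS](cat_take_drop n) (drop_nth x) // (onth_nth x _ _ _ E).
Qed.

Lemma tauE w x : center_letter w = Some x ->
  tau (word w) (center w) = (index x (sort <=%O (word w))).+1.
Proof. by rewrite /center_letter /tau => ->. Qed.

Lemma dfloor_tau_eq u v : perm_eq (word u) (word v) ->
  center_letter u = center_letter v -> dfloor_tau u = dfloor_tau v.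
Proof.
move=> uv cuv; have [_ [x [_ [_ _ vx]]]] := center_split v.
have ux : center_letter u = Some x by rewrite cuv.
have suv : sort <=%O (word u) = sort <=%O (word v).
  by apply/perm_sortP => //; [exact: le_total|exact: le_trans|exact: le_anti].
by apply: diword_eq; rewrite ?center_dfloor_tau ?(tauE ux) ?(tauE vx) ?suv.
Qed.

Lemma perm_dfloor_tau w : perm_eq (word (dfloor_tau w)) (word w).
Proof. by rewrite word_dfloor_tau perm_sort. Qed.

Lemma center_letter_dfloor_tau w :
  center_letter (dfloor_tau w) = center_letter w.
Proof.
have [a [x [b [wab _ wx]]]] := center_split w.
rewrite wx /center_letter word_dfloor_tau center_dfloor_tau (tauE wx) /=.
have xw : x \in sort <=%O (word w).
  by rewrite mem_sort wab mem_cat mem_head orbT.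
have := xw; rewrite -index_mem -onthTE.
by case E: (onth _ _) => [y|] // _; rewrite -(onth_nth x _ _ _ E) nth_index.
Qed.

Lemma dfloor_tauK w : dfloor_tau (dfloor_tau w) = dfloor_tau w.
Proof.
by apply: dfloor_tau_eq; rewrite ?perm_dfloor_tau ?center_letter_dfloor_tau.
Qed.

Lemma dfloor_tau_lv u v :
  dfloor_tau (dwlv (dfloor_tau u) (dfloor_tau v)) = dfloor_tau (dwlv u v).
Proof.
apply: dfloor_tau_eq; first by rewrite perm_cat ?perm_dfloor_tau.
by rewrite !center_letter_lv center_letter_dfloor_tau.
Qed.

Lemma dfloor_tau_rv u v :
  dfloor_tau (dwrv (dfloor_tau u) (dfloor_tau v)) = dfloor_tau (dwrv u v).
Proof.
apply: dfloor_tau_eq; first by rewrite perm_cat ?perm_dfloor_tau.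
by rewrite !center_letter_rv center_letter_dfloor_tau.
Qed.

(** Among the rearrangements of a word the sorted one is least. If the word is already sorted, the
    centers decide: the first occurrence of the center letter does not come after the center. *)
Lemma dfloor_tau_le w : diword_le (dfloor_tau w) w.
Proof.
rewrite /diword_le /deglex_lt word_dfloor_tau size_sort ltnn eqxx /=.
have := @sorted_lexi_min (word w) _ (sort_le_sorted _) (permEl (perm_sort _ _)).
rewrite le_eqVlt => /predU1P[sw|->//].
rewrite sw; apply/orP; right; rewrite eqxx /= center_dfloor_tau.
have [a [x [b [wab cw wx]]]] := center_split w.
rewrite (tauE wx) sw cw ltnS wab index_cat.
by case: ifP => [_|_]; rewrite ?index_size //= eqxx addn0.
Qed.

Lemma dfloor_tau_short w : (size (word w) < 2)%N -> dfloor_tau w = w.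
Proof.
case/andP: (diwordP w) => c0 cw sw.
have sz : size (word w) = 1%N by apply/eqP; rewrite eqn_leq -ltnS sw (leq_trans c0).
have c1 : center w = 1%N by apply/eqP; rewrite eqn_leq c0 andbT -sz.
move: sz; case E: (word w) => [|x [|]] // _.
have wx : center_letter w = Some x by rewrite /center_letter c1 E.
apply: diword_eq; first by rewrite word_dfloor_tau E.
by rewrite center_dfloor_tau (tauE wx) E c1 /= eqxx.
Qed.

(** Both sides say that the word is sorted and that its center letter does not occur before the
    center. *)
Lemma center_firstP w : center_first w <-> dfloor_tau w = w.
Proof.
have [a [x [b [wab cw wx]]]] := center_split w.
have fixE : dfloor_tau w = w <-> sorted <=%O (word w) /\ x \notin a.
  split=> [ww|[sw xa]].
    have sw : sorted <=%O (word w) by rewrite -ww; apply: sort_le_sorted.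
    split=> //; move/(congr1 (@center d X)): ww.
    rewrite center_dfloor_tau (tauE wx) (sort_le_id sw) cw wab index_cat => -[].
    by case: ifP => // xa e; move: xa; rewrite -index_mem e ltnn.
  apply: diword_eq; first exact: sort_le_id.
  rewrite center_dfloor_tau (tauE wx) (sort_le_id sw) cw wab index_cat (negPf xa) /=.
  by rewrite eqxx addn0.
apply: iff_trans (iff_sym fixE); split=> [cf|[sw xa] x0 i iw].
  have le_nth i : (i.+1 < size (word w))%N ->
      (nth x (word w) i <= nth x (word w) i.+1)%O.
    by move=> /(cf x); case: ifP => // _ /ltW.
  have sw : sorted <=%O (word w) by apply/(sortedP x).
  (* The strict inequality at index [size a] gives [y < x] for the letter [y] just before the
     center, while an earlier occurrence of [x] would give [x <= y] by sortedness. *)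
  split=> //; apply/negP; case/lastP: a wab cw {fixE} => // a y wab cw.
  have := cf x (size a); rewrite cw size_rcons eqxx wab size_cat size_rcons /=.
  rewrite addnS ltnS ltnS leq_addr => /(_ isT).
  rewrite !nth_cat !size_rcons ltnSn ltnn subnn /= nth_rcons ltnn eqxx => yx.
  move=> /(nthP x)[j]; rewrite size_rcons ltnS => ja ax.
  have aw : (size a < size (word w))%N.
    by rewrite wab size_cat size_rcons addSn ltnS leq_addr.
  have : (nth x (word w) j <= nth x (word w) (size a))%O.
    by apply: (sorted_leq_nth le_trans le_refl) => //; rewrite inE (leq_ltn_trans ja).
  rewrite wab !nth_cat !size_rcons ltnS ja ltnSn ax nth_rcons ltnn eqxx => xy.
  by have := lt_le_trans yx xy; rewrite ltxx.
have le_i : (nth x0 (word w) i <= nth x0 (word w) i.+1)%O.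
  by move/(sortedP x0): sw; apply.
case: eqP => // ic; rewrite lt_neqAle le_i andbT.
(* Now [i.+1 = size a] is the index of the center letter [x], so equality of the two letters would
   put [x] in [a]. *)
move: ic; rewrite cw => -[ia].
rewrite wab !nth_cat -ia ltnSn ltnn subnn /=.
by apply: contra xa => /eqP <-; rewrite mem_nth // -ia.
Qed.

Lemma diword_max (r : seq (diword X)) w : w \in r ->
  exists2 u, u \in r & {in r, forall v, diword_le v u}.
Proof.
elim: r w => // v r IH _ _; case: r => [|v' r] in IH *.
  by exists v => [|_ /[1!inE]/eqP->]; rewrite ?mem_head ?diword_leE.
have [u ur ru] := IH v' (mem_head _ _).
have [uv|vu] := leP (diword_key u) (diword_key v).
  exists v => [|x /[1!in_cons] /predU1P[->|/ru]]; first exact: mem_head.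
    by rewrite diword_leE.
  by rewrite !diword_leE => /le_trans; apply.
exists u => [|x /[1!in_cons] /predU1P[->|/ru //]]; first by rewrite in_cons ur orbT.
by rewrite diword_leE ltW.
Qed.

End Diwords.

(** * Abelian dialgebras *)

Section AbelianDialgebra.
Variables (k : fieldType) (D : dialgebraType k) (abD : Defs.abelian D).
Variables (d : Order.disp_t) (X : orderType d) (phi : diword X -> D).
Hypothesis phi_lv : forall u v, phi (dwlv u v) = phi u ⊢ phi v.
Hypothesis phi_rv : forall u v, phi (dwrv u v) = phi u ⊣ phi v.

Let rmul (z : D) (y : X) : D := z ⊣ phi (dwletter y).

(** Right multiplications commute: [(z ⊣ x) ⊣ y = z ⊣ (x ⊣ y) = z ⊣ (y ⊢ x) = z ⊣ (y ⊣ x) = (z ⊣ y)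
    ⊣ x]. *)
Lemma foldl_rmul_perm z (s t : seq X) :
  perm_eq s t -> foldl rmul z s = foldl rmul z t.
Proof.
have rmulAC u x y : rmul (rmul u x) y = rmul (rmul u y) x.
  by rewrite /rmul -!drvA -(abD (phi _) (phi (dwletter x))) drv_lv.
have rmul_foldl u y p : foldl rmul (rmul u y) p = rmul (foldl rmul u p) y.
  by elim: p u => //= x p IH u; rewrite rmulAC IH.
apply: catCA_perm_subst => s1 s2 s3; rewrite !foldl_cat; congr foldl.
by elim: s1 z => //= y s1 IH z; rewrite IH rmul_foldl.
Qed.

(** Letters after the center are split off from the right. A letter before it passes to the far
    right by [abD], the first letter of the word ending up last, hence [rev a]. *)
Lemma phi_foldl w a x b : word w = a ++ x :: b -> center w = (size a).+1 ->
  phi w = foldl rmul (phi (dwletter x)) (b ++ rev a).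
Proof.
elim: a w => [|y a IH] w /= wab cw.
  rewrite cats0; elim/last_ind: b w wab cw => [|b y IH] w wab cw.
    by congr phi; apply: diword_eq.
  have [w' [wb cw']] : exists w', word w' = x :: b /\ center w' = 1%N.
    by exists (@Diword _ _ (x :: b, 1%N) isT).
  have -> : w = dwrv w' (dwletter y).
    by apply: diword_eq; rewrite ?word_rv ?center_rv ?wb ?cw' // wab -cats1.
  by rewrite phi_rv foldl_rcons -(IH w').
have [w' [wb cw']] : exists w', word w' = a ++ x :: b /\ center w' = (size a).+1.
  have aw : (0 < (size a).+1 <= size (a ++ x :: b))%N.
    by rewrite size_cat /= addnS ltnS leq_addr.
  by exists (@Diword _ _ (_, _) aw).
have -> : w = dwlv (dwletter y) w'.
  by apply: diword_eq; rewrite ?word_lv ?center_lv ?wb ?cw' // wab.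
by rewrite phi_lv abD rev_cons -rcons_cat foldl_rcons -(IH w').
Qed.

Lemma phi_dfloor_tau w : phi (dfloor_tau w) = phi w.
Proof.
have [a [x [b [wab cw wx]]]] := center_split w.
have [a' [x' [b' [wab' cw' wx']]]] := center_split (dfloor_tau w).
have xx' : x' = x by move: wx'; rewrite center_letter_dfloor_tau wx => -[].
rewrite (phi_foldl wab cw) (phi_foldl wab' cw') xx'; apply: foldl_rmul_perm.
have := perm_dfloor_tau w; rewrite wab wab' xx' => /permPl pab.
(* Putting the common center letter back reduces the claim to [pab], by counting. *)
rewrite -(perm_cons x); apply/permP => p; have /permP/(_ p) := permEl pab.
by rewrite /= !count_cat /= !count_rev !addnA ![(_ + count p b)%N]addnC; lia.
Qed.

End AbelianDialgebra.

(** * Linear extension of a map of basis elements *)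

Section MalgMap.
Variables (k : fieldType) (K : choiceType).
Local Notation A := {malg k[K]}.

Lemma malg_sum (f : A) : f = \sum_(w <- msupp f) f@_w *: << w >>.
Proof.
rewrite [LHS]monalgE; apply: eq_bigr => w _.
by apply/malgP => v; rewrite mcoeffZ !mcoeffU mulrnAr mulr1.
Qed.

Lemma malgU_inj : injective (fun w : K => << w >> : A).
Proof.
move=> u v /(congr1 (mcoeff v)); rewrite !mcoeffU eqxx.
by case: eqP => // _ /eqP; rewrite eq_sym oner_eq0.
Qed.

Lemma mcoeffBU (u v w : K) :
  (<< u >> - << v >> : A)@_w = (u == w)%:R - (v == w)%:R.
Proof. by rewrite mcoeffB !mcoeffU. Qed.

Lemma mcoeff_lsum I (r : seq I) (c : I -> k) (F : I -> A) w :
  (\sum_(i <- r) c i *: F i)@_w = \sum_(i <- r) c i * (F i)@_w.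
Proof. by rewrite raddf_sum; apply: eq_bigr => i _; rewrite /= mcoeffZ. Qed.

Definition malg_map (h : K -> K) : A -> A := lin_ext (fun w => << h w >>).

Variable h : K -> K.
Local Notation nf := (malg_map h).

Lemma malg_mapP c f g : nf (c *: f + g) = c *: nf f + nf g.
Proof. exact: lin_extP. Qed.

Lemma malg_map0 : nf 0 = 0.
Proof. by rewrite /nf /lin_ext msupp0 big_seq_fset0. Qed.

Lemma malg_mapB f g : nf (f - g) = nf f - nf g.
Proof. by rewrite addrC -scaleN1r malg_mapP scaleN1r addrC. Qed.

Lemma malg_mapU w : nf << w >> = << h w >>.
Proof. exact: lin_extU. Qed.

(** Subtract [nf f], which is 0, from [f] term by term. That the sum runs over the support of [f]
    itself is what later bounds the leading diwords. *)
Lemma malg_map_sum f : nf f = 0 ->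
  f = \sum_(w <- msupp f) f@_w *: (<< w >> - << h w >>).
Proof.
move=> f0; rewrite -[LHS]subr0 -[in LHS]f0 {1}[f]malg_sum /nf /lin_ext -sumrB.
by apply: eq_bigr => w _; rewrite scalerBr.
Qed.

Lemma malg_map_lsum I (r : seq I) (c : I -> k) (F : I -> A) :
  nf (\sum_(i <- r) c i *: F i) = \sum_(i <- r) c i *: nf (F i).
Proof.
elim: r => [|i r IH]; first by rewrite !big_nil malg_map0.
by rewrite !big_cons malg_mapP IH.
Qed.

(** A nonzero coefficient at [w] comes from some [u] with [h u = w], and then
    [h w = h (h u) = w]. *)
Lemma malg_map_supp f w : (forall u, h (h u) = h u) ->
  w \in msupp (nf f) -> h w = w.
Proof.
move=> hK; rewrite -mcoeff_neq0; apply: contra_neq_eq => hw.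
rewrite /malg_map /lin_ext raddf_sum big1 // => u _.
rewrite /= mcoeffZ mcoeffU; case: eqP => [huw|_]; last by rewrite mulr0.
by case/eqP: hw; rewrite -huw hK.
Qed.

Lemma malg_map_idem f : (forall u, h (h u) = h u) -> nf (nf f) = nf f.
Proof.
move=> hK; rewrite [RHS]malg_sum [LHS]/malg_map /lin_ext.
by apply: eq_big_seq => w /(malg_map_supp hK) ->.
Qed.

Lemma malg_map_bilin_ext (op : K -> K -> K) :
  (forall u v, h (op (h u) (h v)) = h (op u v)) ->
  forall f g, nf (bilin_ext op (nf f) (nf g)) = nf (bilin_ext op f g).
Proof.
move=> hop f g; elim/malg_lin_ind: f => [|c f1 f2 IH1 IH2|u].
- by rewrite malg_map0 !bilin_ext0l.
- rewrite (malg_mapP c f1) !bilin_extPl [LHS]malg_mapP [RHS]malg_mapP.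
  exact: (congr2 (fun x y => c *: x + y) IH1 IH2).
elim/malg_lin_ind: g => [|c f1 f2 IH1 IH2|v].
- by rewrite malg_map0 !bilin_ext0r.
- rewrite (malg_mapP c f1) !bilin_extPr [LHS]malg_mapP [RHS]malg_mapP.
  exact: (congr2 (fun x y => c *: x + y) IH1 IH2).
by rewrite !malg_mapU !bilin_extUU !malg_mapU hop.
Qed.

End MalgMap.

(** * The ideal, the compositions and the basis *)

Section NormalForm.
Variables (k : fieldType) (d : Order.disp_t) (X : orderType d).
Local Notation Di := (Di k X).
Local Notation base := (@Defs.base k d X).
Implicit Types (f g h : Di) (u v w : diword X).

Definition nf : Di -> Di := locked (malg_map (@dfloor_tau d X)).

Lemma nfP c f g : nf (c *: f + g) = c *: nf f + nf g.
Proof. rewrite /nf -lock; exact: malg_mapP. Qed.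

Lemma nf0 : nf 0 = 0.
Proof. rewrite /nf -lock; exact: malg_map0. Qed.

Lemma nfB f g : nf (f - g) = nf f - nf g.
Proof. rewrite /nf -lock; exact: malg_mapB. Qed.

Lemma nf_base w : nf (base w) = base (dfloor_tau w).
Proof. rewrite /nf -lock; exact: malg_mapU. Qed.

Lemma nf_baseB u v :
  nf (base u - base v) = base (dfloor_tau u) - base (dfloor_tau v).
Proof. by rewrite nfB; apply: (congr2 (fun f g => f - g)); apply: nf_base. Qed.

Lemma base_lv u v : base u ⊢ base v = base (dwlv u v).
Proof. exact: bilin_extUU. Qed.

Lemma base_rv u v : base u ⊣ base v = base (dwrv u v).
Proof. exact: bilin_extUU. Qed.

Lemma base_inj : injective base.
Proof. exact: malgU_inj. Qed.

Lemma Di_sum f : f = \sum_(w <- msupp f) f@_w *: base w.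
Proof. exact: malg_sum. Qed.

Lemma nf_lv f g : nf (nf f ⊢ nf g) = nf (f ⊢ g).
Proof. rewrite /nf -lock; exact: (malg_map_bilin_ext (@dfloor_tau_lv d X)). Qed.

Lemma nf_rv f g : nf (nf f ⊣ nf g) = nf (f ⊣ g).
Proof. rewrite /nf -lock; exact: (malg_map_bilin_ext (@dfloor_tau_rv d X)). Qed.

Lemma Di_lv0 f : (0 ⊢ f = 0) * (f ⊢ 0 = 0).
Proof. by split; [exact: bilin_ext0l|exact: bilin_ext0r]. Qed.

Lemma Di_rv0 f : (0 ⊣ f = 0) * (f ⊣ 0 = 0).
Proof. by split; [exact: bilin_ext0l|exact: bilin_ext0r]. Qed.

Definition ker_nf : set Di := [set f | nf f = 0].

(** Under [nf], the factors of a product may be replaced by their normal forms, one of which is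
    0. *)
Lemma ker_nf_ideal : is_ideal ker_nf.
Proof.
rewrite /ker_nf; split=> [|c f g /= f0 g0|f g /= f0]; first exact: nf0.
  by rewrite nfP f0 g0 scaler0 addr0.
split; [rewrite -(nf_lv f g)|rewrite -(nf_lv g f)|rewrite -(nf_rv f g)|
  rewrite -(nf_rv g f)]; by rewrite f0 ?(Di_lv0, Di_rv0) nf0.
Qed.

Lemma ker_nf_sum f : ker_nf f ->
  f = \sum_(w <- msupp f) f@_w *: (base w - base (dfloor_tau w)).
Proof. rewrite /ker_nf /nf -lock; exact: malg_map_sum. Qed.

Lemma ideal_sum (J : set Di) I (r : seq I) (c : I -> k) (F : I -> Di) :
  is_ideal J -> (forall i, J (F i)) -> J (\sum_(i <- r) c i *: F i).
Proof.
move=> [J0 JP _] JF; elim: r => [|i r IH]; first by rewrite big_nil.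
by rewrite big_cons; apply: JP.
Qed.

(** The length condition holds because a diword of length 1 is its own normal form. *)
Lemma SsetP w : base w - base (dfloor_tau w) != 0 ->
  Sset k X (base w - base (dfloor_tau w)).
Proof.
move=> w0; split=> //; exists w; split=> //.
by rewrite leqNgt; apply: contra w0 => /dfloor_tau_short ->; rewrite subrr.
Qed.

Lemma Sset_ker_nf f : Sset k X f -> ker_nf f.
Proof.
move=> [_ [w [_ ->]]]; apply: etrans (nf_baseB _ _) _.
by rewrite dfloor_tauK subrr.
Qed.

Lemma Tset_ker_nf f : Tset k X f -> ker_nf f.
Proof.
move=> [u [v ->]]; rewrite base_lv base_rv; apply: etrans (nf_baseB _ _) _.
rewrite [dfloor_tau (dwlv u v)](@dfloor_tau_eq _ _ _ (dwrv v u)) ?subrr //.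
  by rewrite word_lv word_rv perm_catC.
by rewrite center_letter_lv center_letter_rv.
Qed.

Lemma ker_nf_Id (S : set Di) : (S `<=` ker_nf)%classic ->
  (forall w, Id S (base w - base (dfloor_tau w))) -> Id S = ker_nf.
Proof.
move=> Sker Sw; apply/seteqP; split=> [|f f0].
  exact: smallest_sub ker_nf_ideal Sker.
rewrite (ker_nf_sum f0); exact: (ideal_sum _ _ (Id_is_ideal S) Sw).
Qed.

Lemma Id_Sset : Id (Sset k X) = ker_nf.
Proof.
apply: ker_nf_Id; first exact: Sset_ker_nf.
move=> w; have [->|w0] := eqVneq (base w - base (dfloor_tau w)) 0.
  by case: (Id_is_ideal (Sset k X)).
by apply: sub_gen_smallest; apply: SsetP.
Qed.

Lemma Id_Tset : Id (Tset k X) = ker_nf.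
Proof.
apply: ker_nf_Id; first exact: Tset_ker_nf.
(* The rewriting takes place in the quotient by [Tset], which is abelian. *)
move=> w; apply/dquot_eq; pose phi w := \pi_(dquot (Tset k X)) (base w).
have phi_lv u v : phi (dwlv u v) = phi u ⊢ phi v by rewrite dquot_pi_lv base_lv.
have phi_rv u v : phi (dwrv u v) = phi u ⊣ phi v by rewrite dquot_pi_rv base_rv.
exact: esym (phi_dfloor_tau (@dquot_Tset_abelian k d X) phi_lv phi_rv w).
Qed.


(** * Leading diwords and triviality modulo [Sset] *)

Lemma lead_Some f w : w \in msupp f -> {in msupp f, forall v, diword_le v w} ->
  lead f = Some w.
Proof.
move=> wf fw; rewrite /lead.
have : w \in [seq u <- msupp f | all (fun v => diword_le v u) (msupp f)].
  by rewrite mem_filter wf andbT; apply/allP.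
case E: [seq _ <- _ | _] => [//|u r] _ /=; congr Some; apply: diword_key_inj.
have : u \in u :: r by exact: mem_head.
rewrite -E mem_filter => /andP[/allP fu uf].
by apply/le_anti; rewrite -!diword_leE fw ?fu.
Qed.

Lemma lead_exists f w : w \in msupp f ->
  exists2 u, lead f = Some u & diword_le w u.
Proof.
move=> wf; have [u uf fu] := diword_max wf.
by exists u; [exact: lead_Some|exact: fu].
Qed.

Lemma lead_baseB u v : u != v -> diword_le v u -> lead (base u - base v) = Some u.
Proof.
move=> uv vu; apply: lead_Some => [|x].
  by rewrite -mcoeff_neq0 mcoeffBU eqxx [v == u]eq_sym (negPf uv) subr0 oner_neq0.
rewrite -mcoeff_neq0 mcoeffBU; case: (u =P x) => [<-|_]; first by rewrite diword_leE.
by case: (v =P x) => [<-|]; rewrite ?subrr ?eqxx.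
Qed.

Lemma lead_Sset w : dfloor_tau w != w ->
  lead (base w - base (dfloor_tau w)) = Some w.
Proof. by move=> ww; apply: lead_baseB (dfloor_tau_le w); rewrite eq_sym. Qed.

Lemma Sset_fixN f : Sset k X f ->
  exists2 w, dfloor_tau w != w & f = base w - base (dfloor_tau w).
Proof.
move=> [f0 [w [_ fw]]]; exists w => //.
by apply: contra_neq f0 => ww; rewrite fw ww subrr.
Qed.

Lemma Sset_monic f : Sset k X f -> Defs.monic f.
Proof.
move=> /Sset_fixN[w ww ->]; rewrite /Defs.monic /lc (lead_Sset ww) /=.
by rewrite mcoeffBU eqxx (negPf ww) subr0.
Qed.

(** With empty [a] and [b], the position [lcenter f] is in [Pset] whether or not [f] is strong;
    being positive, it selects the middle case of [nsd], which is [f]. *)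
Lemma normal_Sdiword_self S f : S f -> (0 < lcenter f)%N -> normal_Sdiword S f.
Proof.
move=> Sf f0; exists [::], f, [::], (lcenter f); rewrite /Pset /nsd /=.
by rewrite !add0n eqxx orbT leqNgt f0; split=> //; case: ifP.
Qed.

Lemma trivial_mod_Sset f : ker_nf f -> trivial_mod (Sset k X) f.
Proof.
move=> f0; pose F w := base w - base (dfloor_tau w).
(* Diwords in normal form contribute 0; each remaining difference is in [Sset], with leading diword
   [w] in the support of [f]. *)
pose r := [seq w <- msupp f | dfloor_tau w != w]; pose t := in_tuple r.
exists (size r), (fun i => f@_(tnth t i)), (fun i => F (tnth t i)); split=> [i|].
  have := mem_tnth i t; rewrite mem_filter => /andP[ww wf].
  have [u fu wu] := lead_exists wf; rewrite (lead_Sset ww) fu; split=> //.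
  apply: normal_Sdiword_self; last first.
    by rewrite /lcenter (lead_Sset ww) /=; case/andP: (diwordP (tnth t i)).
  apply: SsetP; apply/eqP => F0; have := lead_Sset ww.
  by rewrite F0 /lead msupp0.
rewrite {1}(ker_nf_sum f0) -(big_tnth _ _ r xpredT (fun w => f@_w *: F w)).
rewrite big_filter; apply/esym/big_rmcond => w /negPn/eqP ww.
by rewrite /F ww subrr scaler0.
Qed.

(** * Compositions inside an ideal *)

Section IdealComposition.
Variables (J : set Di) (Jideal : is_ideal J).

Let J_mul f g : J f -> [/\ J (f ⊢ g), J (g ⊢ f), J (f ⊣ g) & J (g ⊣ f)].
Proof. by case: Jideal => _ _; apply. Qed.

Lemma ideal_sub f g : J f -> J g -> J (f - g).
Proof.
case: Jideal => _ JP _ Jf Jg; rewrite addrC -scaleN1r; exact: JP Jg Jf.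
Qed.

Lemma ideal_nsd a f b l : J f -> J (nsd a f b l).
Proof.
have Jl g (c : seq X) : J g -> J (lv_word c g).
  case: c => [//|x c Jg].
  by have [_ Jcg _ _] := J_mul (mono k (x :: c) (size (x :: c))) Jg; exact: Jcg.
have Jr g (c : seq X) : J g -> J (rv_word g c).
  case: c => [//|x c Jg].
  by have [_ _ Jgc _] := J_mul (mono k (x :: c) 1) Jg; exact: Jgc.
move=> Jf; rewrite /nsd; case: ifP => _.
  by have [_ _ _ Jaf] := J_mul (mono k a l) Jf; exact: Jr Jaf.
case: ifP => _; first exact/Jr/Jl.
by have [Jfb _ _ _] := J_mul (mono k b (l - size (a ++ lword f))) (Jl _ a Jf);
  exact: Jfb.
Qed.

Lemma ideal_composition f g h : J f -> J g -> composition f g h -> J h.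
Proof.
move=> Jf Jg; case.
- by move=> x _; have [_ _ _ Jxf] := J_mul (letter k x) Jf; exact: Jxf.
- by move=> u _ _; have [Jfu _ _ _] := J_mul (mono k u (size u)) Jf; exact: Jfu.
- by move=> a b _ _; apply: ideal_sub Jf (ideal_nsd _ _ _ Jg).
all: by move=> *; apply: ideal_sub (ideal_nsd _ _ _ Jf) (ideal_nsd _ _ _ Jg).
Qed.

End IdealComposition.

Lemma GSB_Sset : GSB (Sset k X).
Proof.
split=> [|f g h Sf Sg fgh]; first exact: Sset_monic.
apply: trivial_mod_Sset; apply: (ideal_composition ker_nf_ideal _ _ fgh);
  exact: Sset_ker_nf.
Qed.

(** * The basis of the quotient *)

Lemma BsetP f : Bset k X f <-> exists2 w, dfloor_tau w = w & f = base w.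
Proof.
(* [dfloor] sorts the word and keeps the center, so it fixes any diword whose word is sorted. *)
have dfloor_fix w : dfloor_tau w = w -> dfloor w = w.
  move=> ww; apply: diword_eq; last by [].
  by have := congr1 (@word d X) ww.
split=> [[w /center_firstP ww <-]|[w ww ->]].
  by exists w; rewrite ?dfloor_fix.
by exists w; [apply/center_firstP|rewrite dfloor_fix].
Qed.

Local Notation Q := (dquot (Tset k X)).
Local Notation pi := (\pi_Q : Di -> Q).

Lemma pi_eq_nf f g : pi f = pi g <-> nf f = nf g.
Proof.
split=> [/dquot_eq|fg]; last apply/dquot_eq; rewrite Id_Tset.
  by move=> fg; apply: subr0_eq; apply: etrans fg; rewrite nfB.
by apply: etrans (nfB _ _) _; rewrite fg subrr.
Qed.

Lemma nf_fix w : dfloor_tau w = w -> nf (base w) = base w.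
Proof. by move=> ww; rewrite nf_base ww. Qed.

Lemma nf_idem f : nf (nf f) = nf f.
Proof. by rewrite /nf -lock; apply/malg_map_idem/dfloor_tauK. Qed.

Lemma nf_fix_supp f w : w \in msupp (nf f) -> dfloor_tau w = w.
Proof. by rewrite /nf -lock; apply/malg_map_supp/dfloor_tauK. Qed.

Lemma nf_sum I (r : seq I) (c : I -> k) (F : I -> Di) :
  nf (\sum_(i <- r) c i *: F i) = \sum_(i <- r) c i *: nf (F i).
Proof. rewrite /nf -lock; exact: malg_map_lsum. Qed.

Lemma pi_sum I (r : seq I) (c : I -> k) (F : I -> Di) :
  pi (\sum_(i <- r) c i *: F i) = \sum_(i <- r) c i *: pi (F i).
Proof.
elim: r => [|i r IH]; last by rewrite !big_cons dquot_piD dquot_piZ IH.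
by rewrite !big_nil; have := dquot_piZ (Tset k X) 0 0; rewrite !scale0r.
Qed.

Lemma pi_inj_Bset : {in Bset k X &, injective pi}.
Proof.
move=> f g /set_mem/BsetP[u uu ->] /set_mem/BsetP[v vv ->] /pi_eq_nf uv.
exact: etrans (esym (nf_fix uu)) (etrans uv (nf_fix vv)).
Qed.

(** Applying [nf] to representatives turns a relation in the quotient into one between distinct
    basis elements of [Di]; the coefficient at [w] then isolates [c q]. *)
Lemma pi_Bset_indep : lin_indep [set pi f | f in Bset k X]%classic.
Proof.
move=> e c e_uniq eB sum0 q qe.
have nf_repr (v : Q) : v \in e ->
    exists2 w, nf (repr v) = base w & v = pi (base w).
  move=> /eB[f /BsetP[w ww ->] <-]; exists w => //.
  by rewrite -[RHS](nf_fix ww); apply/pi_eq_nf; rewrite reprK.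
have nf_sum0 : \sum_(v <- e) c v *: nf (repr (v : Q)) = 0.
  rewrite -nf_sum -[RHS]nf0; apply/pi_eq_nf; rewrite pi_sum.
  under eq_bigr do rewrite reprK.
  by rewrite sum0; have := dquot_piZ (Tset k X) 0 0; rewrite !scale0r.
have [w qw q_pi] := nf_repr q qe.
have coef_w (v : Q) : v \in e -> (nf (repr v))@_w = (v == q)%:R.
  move=> ve; have [w' vw' v_pi] := nf_repr v ve.
  rewrite vw' mcoeffU; congr (_ %:R); congr nat_of_bool.
  apply/eqP/eqP => [w'w|vq].
    by rewrite v_pi w'w -q_pi.
  by apply: base_inj; rewrite -vw' vq.
have := congr1 (mcoeff w) nf_sum0; rewrite mcoeff_lsum mcoeff0.
rewrite (bigD1_seq q) //= coef_w // eqxx mulr1 big_seq_cond big1 ?addr0 // => v.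
by case/andP => ve /negPf vq; rewrite coef_w // vq mulr0.
Qed.

Lemma pi_Bset_span : lin_span [set pi f | f in Bset k X]%classic = setT.
Proof.
apply/seteqP; split=> // q _; rewrite -[q]reprK.
have -> : pi (repr q) = pi (nf (repr q)) by apply/pi_eq_nf; rewrite nf_idem.
set g := nf _; rewrite [g]Di_sum pi_sum.
pose e := [fset pi (base w) | w in msupp g]%fset.
(* Coefficients are indexed by elements of the quotient, so those of [g] are summed over the fibres
   of [w] mapped to [pi (base w)]. *)
exists e, (fun v : Q => \sum_(w <- msupp g | pi (base w) == v) g@_w); split.
  move=> v /imfsetP[w /= wg ->]; exists (base w) => //; apply/BsetP.
  by exists w => //; apply: nf_fix_supp wg.
rewrite (partition_big_imfset _ (fun w => pi (base w))) /=.
apply: eq_bigr => v _; rewrite scaler_suml.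
by apply: eq_bigr => w /eqP ->.
Qed.

End NormalForm.

Theorem proposition5p7 (k : fieldType) (d : Order.disp_t) (X : orderType d)
    (Xwo : well_order (<=%O : rel X)) :
  [/\ Id (Tset k X) = Id (Sset k X),
      GSB (Sset k X) &
      is_quot_basis (Tset k X) (Bset k X)].
Proof.
split; first by rewrite Id_Tset Id_Sset.
  exact: GSB_Sset.
by split; [exact: pi_inj_Bset|split; [exact: pi_Bset_indep|exact: pi_Bset_span]].
Qed.
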